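(* Let $r\in(0,1)$, let $\Phi$ be a gauge, and let $\mathcal{B}=(T,E_{\mathcal{B}})$ be an infinite bounded-degree demand network with root $o$ for which $(\mathcal{B},\Phi,r)$ has macroscopic gauge-energy stability. Let a bounded-range local repair model be placed over $\mathcal{B}$, with physical network $H$, and let $(Y_e)_{e\in E_{\mathcal{B}}}$ be its repairability field under Bernoulli failures of the physical edges. Let $R<\infty$ and let $L,K\ge1$ be integers with $\alpha_\Phi(m)<\infty$ for $1\le m\le K$. Assume that: (i) $(Y_e)$ is $R$-dependent; (ii) for the domination threshold $\rho(R,r)$, $\inf_{e\in E_{\mathcal{B}}}\mathbb{P}(Y_e=1)\ge\rho(R,r)$; (iii) whenever $Y_e=1$, one can choose an open repair route for $e$ so that every selected route family over the subgraph of demand edges under consideration is $(L,K)$-controlled. Then, with positive probability, the open physical network contains a component supporting a finite $\Phi$-energy unit flow to infinity. More precisely, on the event that the dominated Bernoulli-$r$ demand component $D$ carries a unit flow $\theta$ with $\mathcal{E}^\Phi_D(\theta)<\infty$, the lifted physical flow $\Theta$ satisfies $$\mathcal{E}^\Phi_H(\Theta)\le L\,\beta_\Phi(K)\,\mathcal{E}^\Phi_D(\theta).$$ For $\Phi(t)=t^2$, this physical component is transient.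
   Context: Graphs are locally finite and undirected; flows are antisymmetric functions on oriented edges. A demand network is a connected locally finite multigraph $\mathcal{B}=(T,E_{\mathcal{B}})$ (parallel edges allowed) with a distinguished root $o\in T$. A physical network is a locally finite graph $H=(V_H,E_H)$ together with an injective map $\iota:T\to V_H$. A unit flow from $o$ to infinity is an antisymmetric function $\theta$ on oriented edges with $\operatorname{div}\theta(o)=1$ and $\operatorname{div}\theta(x)=0$ for $x\ne o$, where $\operatorname{div}\theta(x)$ is the sum of $\theta$ over all oriented edges leaving $x$. A gauge is an increasing convex function $\Phi:[0,\infty)\to[0,\infty)$ with $\Phi(0)=0$ (increasing is understood strictly). The $\Phi$-energy on a graph $X$ is $\mathcal{E}^\Phi_X(\theta)=\sum_{e\in E_X}\Phi(|\theta(e)|)$ over unoriented edges. For integers $m\ge1$ put $\alpha_\Phi(m)=\sup_{t>0}\Phi(mt)/\Phi(t)$, and $\beta_\Phi(K)=\max_{1\le m\le K}\alpha_\Phi(m)/m$. Macroscopic gauge-energy stability of $(\mathcal{B},\Phi,r)$: Bernoulli-$r$ bond percolation on $\mathcal{B}$ has, with positive probability, an open connected component containing $o$ that supports a unit flow from $o$ to infinity of finite $\Phi$-energy. Local repair model: for each demand edge $e=\{u,v\}$ a family $\Gamma_e$ of candidate routes (finite paths in $H$ joining $\iota(u)$ to $\iota(v)$) is specified; bounded range means that the routes in $\Gamma_e$ stay within a uniformly bounded neighbourhood of $e$. Physical edges are independently open with probability $p$ and closed (failed) otherwise; the open physical network $H[p]$ consists of the open edges. $Y_e=1$ if some route in $\Gamma_e$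 has all its edges open, and $Y_e=0$ otherwise. A family of selected routes $\{\gamma_e\}_{e\in F}$, one for each edge of a set $F$ of demand edges, is $(L,K)$-controlled if each $\gamma_e$ has at most $L$ edges and each physical edge lies on at most $K$ of the $\gamma_e$, $e\in F$. The field $(Y_e)$ is $R$-dependent if $(Y_e)_{e\in A}$ and $(Y_e)_{e\in A'}$ are independent whenever $A,A'\subseteq E_{\mathcal{B}}$ are at edge-distance greater than $R$ in $\mathcal{B}$. Domination threshold (Liggett–Schonmann–Stacey): $\rho(R,r)<1$ is a number such that every $R$-dependent $\{0,1\}$-valued field $(Y_e)$ on $E_{\mathcal{B}}$ with $\inf_e\mathbb{P}(Y_e=1)\ge\rho(R,r)$ stochastically dominates the independent Bernoulli-$r$ field. Under this domination there is a coupling of $(Y_e)$ with an independent Bernoulli-$r$ field $(\omega_e)$ such that $\omega_e\le Y_e$ for all $e$ almost surely; the dominated Bernoulli-$r$ demand component $D$ is the component of $o$ in the subgraph $\{e:\omega_e=1\}$, with edge set $F_D$. Lifted flow: orient each $e\in F_D$, orient the selected open route $\gamma_e$ consistently, let $\eta_e$ be the unit path flow along $\gamma_e$ ($1$ on edges traversed in the direction of $\gamma_e$, $-1$ on reversed edges, $0$ elsewhere), where the selected routes form an $(L,K)$-controlled family as in (iii). The lift of $\theta$ is $\Theta=\sum_{e\in F_D}\theta(e)\eta_e$, a unit flow from $\iota(o)$ to infinity on the open physical network. *)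

(* Defs.v *)
From HB Require Import structures.
From mathcomp Require Import all_boot all_order all_algebra.
From mathcomp Require Import all_classical all_reals all_analysis.

Set Implicit Arguments.
Unset Strict Implicit.
Unset Printing Implicit Defensive.

Import Order.TTheory GRing.Theory Num.Theory.
Import numFieldNormedType.Exports.

Local Open Scope classical_set_scope.
Local Open Scope card_scope.
Local Open Scope ring_scope.

(** * Multigraphs *)

(* Undirected: [src] and [tgt] only fix a reference orientation of each edge.
   Parallel edges and loops are allowed. *)
Record multigraph := Multigraph {
  vertex : choiceType;
  edge : choiceType;
  src : edge -> vertex;
  tgt : edge -> vertex }.

Section Graph.
Variable G : multigraph.

(* [(e, true)] is [e] oriented from [src e] to [tgt e], [(e, false)] is the
   reversed orientation. *)
Definition dart : choiceType := (edge G * bool)%type.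

Definition dtail (a : dart) : vertex G := if a.2 then src a.1 else tgt a.1.
Definition dhead (a : dart) : vertex G := if a.2 then tgt a.1 else src a.1.
Definition rev_dart (a : dart) : dart := (a.1, ~~ a.2).

Definition out_darts (F : set (edge G)) (x : vertex G) : set dart :=
  [set a | dtail a = x /\ F a.1].

Definition locally_finite : Prop := forall x, finite_set (out_darts setT x).

Definition bounded_degree : Prop :=
  exists d : nat, forall x, out_darts setT x #<= `I_d.

Fixpoint walk (x : vertex G) (w : seq dart) (y : vertex G) : Prop :=
  if w is a :: w' then dtail a = x /\ walk (dhead a) w' y else x = y.

Definition walk_in (F : set (edge G)) (w : seq dart) : Prop :=
  forall a, a \in w -> F a.1.

(* Self-avoiding walk. *)
Definition simple_path (x : vertex G) (w : seq dart) (y : vertex G) : Prop :=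
  walk x w y /\ uniq (x :: map dhead w).

(* Vertices and edges of the component of [x] in the spanning subgraph with
   edge set [F]. *)
Definition cluster (F : set (edge G)) (x : vertex G) : set (vertex G) :=
  [set y | exists w, walk x w y /\ walk_in F w].

Definition cluster_edges (F : set (edge G)) (x : vertex G) : set (edge G) :=
  [set e | F e /\ cluster F x (src e)].

Definition connected_graph : Prop := forall x y, cluster setT x y.

Definition within_dist (n : nat) (x y : vertex G) : Prop :=
  exists w, walk x w y /\ (size w <= n)%N.

Definition share_endpoint (e f : edge G) : Prop :=
  exists x, (x = src e \/ x = tgt e) /\ (x = src f \/ x = tgt f).

(* Distance between edges is distance in the line graph. *)
Fixpoint within_edge_dist (n : nat) (e f : edge G) : Prop :=
  if n is m.+1 then
    within_edge_dist m e f \/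
    exists g, within_edge_dist m e g /\ share_endpoint g f
  else e = f.

Definition edge_separated (n : nat) (A A' : set (edge G)) : Prop :=
  forall e f, A e -> A' f -> ~ within_edge_dist n e f.

End Graph.

(** * Gauges, flows and energy *)

Section Flow.
Variable R : realType.

(* A gauge lives on [0, +oo[: the values of [Phi] at negative reals are
   irrelevant. *)
Definition gauge (Phi : R -> R) : Prop :=
  [/\ Phi 0 = 0,
      (forall s t, 0 <= s -> s < t -> Phi s < Phi t) &
      convex_function (`[0, +oo[%classic : set R^o) Phi].

Local Open Scope ereal_scope.

Definition gauge_alpha (Phi : R -> R) (m : nat) : \bar R :=
  ereal_sup [set (Phi (m%:R * t) / Phi t)%R%:E | t in [set t : R | (0 < t)%R]].

Definition gauge_beta (Phi : R -> R) (K : nat) : \bar R :=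
  \big[maxe/-oo]_(1 <= m < K.+1) (gauge_alpha Phi m * (m%:R^-1)%R%:E).

Local Close Scope ereal_scope.

Variable G : multigraph.
Implicit Types (F : set (edge G)) (theta : dart G -> R).

Definition antisymmetric_flow theta : Prop :=
  forall a, theta (rev_dart a) = - theta a.

Definition divergence theta (x : vertex G) : R :=
  \sum_(a \in out_darts setT x) theta a.

(* A flow on a subgraph is a flow on [G] vanishing off the subgraph. *)
Definition unit_flow F (o : vertex G) theta : Prop :=
  [/\ antisymmetric_flow theta,
      (forall a, ~ F a.1 -> theta a = 0),
      divergence theta o = 1 &
      (forall x, x <> o -> divergence theta x = 0)].

Definition energy (Phi : R -> R) F theta : \bar R :=
  \esum_(e in F) (Phi `|theta (e, true)|)%:E.

Definition supports_finite_energy_flow (Phi : R -> R) F (o : vertex G) : Prop :=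
  exists theta, unit_flow (cluster_edges F o) o theta /\
    (energy Phi (cluster_edges F o) theta < +oo)%E.

Definition path_flow (w : seq (dart G)) : dart G -> R :=
  fun a => if a \in w then 1 else if rev_dart a \in w then -1 else 0.

(** * Simple random walk and transience *)

(* One step of simple random walk on the spanning subgraph with edge set [F];
   the walk stays put at isolated vertices. *)
Definition walk_average F (f : vertex G -> R) (x : vertex G) : R :=
  let d := \sum_(a \in out_darts F x) (1 : R) in
  if d == 0 then f x else (\sum_(a \in out_darts F x) f (dhead a)) / d.

(* Probability that the walk started at [y] visits [x] at one of the times
   0, ..., n. *)
Fixpoint hit_prob F (x : vertex G) (n : nat) (y : vertex G) : R :=
  if y == x then 1 else
  if n is m.+1 then walk_average F (hit_prob F x m) y else 0.

(* Probability that the walk started at [x] is back at [x] at some time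
   n >= 1. *)
Definition return_prob F (x : vertex G) : R :=
  sup (range (fun n => walk_average F (hit_prob F x n) x)).

Definition transient_cluster F (x : vertex G) : Prop :=
  forall y, cluster F x y -> return_prob F y < 1.

End Flow.

(** * Random fields of bits *)

Section Field.
Variable R : realType.

(* Product sigma-algebra on {0,1}^E. *)
Definition product_measurable (E : Type) (U : set (E -> bool)) : Prop :=
  <<s [set [set c : E -> bool | c e] | e in [set: E]] >> U.

Definition increasing_event (E : Type) (U : set (E -> bool)) : Prop :=
  forall c c' : E -> bool, U c -> (forall e, c e -> c' e) -> U c'.

Section OneField.
Variables (d : measure_display) (W : measurableType d) (P : probability W R).
Variables (E : choiceType) (X : W -> E -> bool).

Definition bit_event (e : E) : set W := [set w | X w e].

Definition random_field : Prop := forall e, measurable (bit_event e).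

Definition bernoulli_field (q : R) : Prop :=
  [/\ random_field,
      (forall e, P (bit_event e) = q%:E) &
      (forall s : seq E, uniq s ->
        P (\bigcap_(e in [set` s]) bit_event e) =
        (\prod_(e <- s) P (bit_event e))%E)].

(* Sigma-algebra generated by [(X_e)_{e in A}]. *)
Definition field_sigma (A : set E) : set (set W) :=
  <<s [set bit_event e | e in A] >>.

(* The event [X \in S] contains a measurable event of positive probability;
   for [S] in the product sigma-algebra this is [0 < P (X \in S)]. *)
Definition with_positive_probability (S : set (E -> bool)) : Prop :=
  exists U, [/\ product_measurable U, U `<=` S & (0 < P (X @^-1` U))%E].

End OneField.

Definition stochastically_dominates (E : choiceType)
    (d : measure_display) (W : measurableType d) (P : probability W R)
    (Y : W -> E -> bool)
    (d' : measure_display) (W' : measurableType d') (P' : probability W' R)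
    (X : W' -> E -> bool) : Prop :=
  forall U, product_measurable U -> increasing_event U ->
    (P' (X @^-1` U) <= P (Y @^-1` U))%E.

Variable B : multigraph.

Definition dependent_field (n : nat)
    (d : measure_display) (W : measurableType d) (P : probability W R)
    (Y : W -> edge B -> bool) : Prop :=
  forall A A' : set (edge B), edge_separated n A A' ->
  forall U V, field_sigma Y A U -> field_sigma Y A' V ->
    P (U `&` V) = (P U * P V)%E.

Definition inf_marginal
    (d : measure_display) (W : measurableType d) (P : probability W R)
    (Y : W -> edge B -> bool) : \bar R :=
  ereal_inf [set P (bit_event Y e) | e in [set: edge B]].

Definition domination_threshold (n : nat) (r rho : R) : Prop :=
  rho < 1 /\
  forall (d : measure_display) (W : measurableType d) (P : probability W R)
    (Y : W -> edge B -> bool),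
  random_field Y -> dependent_field n P Y -> (rho%:E <= inf_marginal P Y)%E ->
  forall (d' : measure_display) (W' : measurableType d')
    (P' : probability W' R) (X : W' -> edge B -> bool),
  bernoulli_field P' X r -> stochastically_dominates P Y P' X.

(* The law of a Bernoulli field is unique, so the choice of the probability
   space is immaterial. *)
Definition gauge_energy_stable (o : vertex B) (Phi : R -> R) (r : R) : Prop :=
  exists (d : measure_display) (W : measurableType d) (P : probability W R)
    (X : W -> edge B -> bool),
  bernoulli_field P X r /\
  with_positive_probability P X
    [set c : edge B -> bool | supports_finite_energy_flow Phi [set e | c e] o].

End Field.

(** * Local repair models *)

(* A route of the demand edge [e] is listed in the direction from
   [site (src e)] to [site (tgt e)]; this is the orientation consistent with
   the reference orientation of [e]. *)
Record repair_model (B H : multigraph) := RepairModel {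
  site : vertex B -> vertex H;
  routes : edge B -> set (seq (dart H));
  site_inj : injective site;
  routes_path : forall e g, routes e g ->
    simple_path (site (src e)) g (site (tgt e));
  routes_bounded_range : exists D : nat, forall e g, routes e g ->
    forall z, z \in site (src e) :: map (@dhead H) g ->
      within_dist D (site (src e)) z \/ within_dist D (site (tgt e)) z }.

Section Repair.
Variables (R : realType) (B H : multigraph) (M : repair_model B H).

Definition repairable (c : edge H -> bool) (e : edge B) : bool :=
  `[< exists g, routes M e g /\ walk_in [set f | c f] g >].

Definition open_selection (c : edge H -> bool) (F : set (edge B))
    (g : edge B -> seq (dart H)) : Prop :=
  forall e, F e -> routes M e (g e) /\ walk_in [set f | c f] (g e).

Definition controlled (L K : nat) (F : set (edge B))
    (g : edge B -> seq (dart H)) : Prop :=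
  (forall e, F e -> (size (g e) <= L)%N) /\
  (forall f : edge H,
    [set e | F e /\ exists2 a, a \in g e & a.1 = f] #<= `I_K).

Definition lift_flow (F : set (edge B)) (g : edge B -> seq (dart H))
    (theta : dart B -> R) : dart H -> R :=
  fun a => \sum_(e \in F) (theta (e, true) * path_flow R (g e) a).

End Repair.

(* Main.v *)
From mathcomp Require Import all_boot all_order all_algebra.
From mathcomp Require Import all_classical all_reals all_analysis.
From mathcomp Require Import ring lra.
Require Import Defs.

(** Conditionally on the failures, the theorem is deterministic.  If the edges
of a demand cluster D are all repaired by open routes, each of length at most
L, with every physical edge on at most K of them, then replacing each demand
edge by its route turns a unit flow [theta] on D into a unit flow on the open
physical network: the divergence of a path flow is carried by its two
endpoints, so the divergences of [theta] are merely transported along the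
injective site map ([divergence_lift], [unit_flow_lift]).  On a physical edge
carrying m routes the lifted value is a signed sum of m values of [theta];
convexity and the definition of alpha give
[Phi (|sum of m terms|) <= (alpha m / m) * (sum of Phi |term|)]
([gauge_sum_le]), and as every demand edge is charged by at most L physical
edges, summing over the physical edges costs the factor [L * beta K]
([energy_lift]).

Positive probability comes from stochastic domination, which speaks only of
measurable increasing events, while stability provides just some measurable
event of positive probability inside the event that the demand component
supports a finite-energy flow.  The latter is the union over n of the events
[flow_event n] that a unit flow of energy at most n exists.  Each of them is
increasing, and it is closed in the product topology on configurations: flows
of bounded energy are uniformly bounded on edges, so by Tychonoff a sequence
of them has a cluster point, to which the linear constraints and the energy
bound pass ([flow_event_closed]).  As the demand network has countably many
edges, closed events are measurable ([product_measurable_closed]).  So one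
[flow_event n] has positive probability under the Bernoulli field, hence under
the dominating repairability field, and its preimage under the map from
physical configurations to repaired edges is the required measurable event.

Transience for quadratic energy is the easy half of the criterion of T. Lyons,
proved without limits ([laplacian_hit_prob_ge]).  Let [h_n] be the probability
of hitting the root x within n steps: it has finite support, is nondecreasing in
n, and therefore is subharmonic off x.  Summation by parts shows that the
pairing of the flow with the gradient of [h_n] is 1 and that the Dirichlet
energy of [h_n] is at most its Laplacian at x, so Cauchy-Schwarz bounds the
escape probability from below uniformly in n.  A finite-energy flow from x
becomes one from any other vertex of the component by adding a path flow
([unit_flow_reroot]). *)

Set Implicit Arguments.
Unset Strict Implicit.
Unset Printing Implicit Defensive.

Import Order.TTheory GRing.Theory Num.Theory.
Import numFieldNormedType.Exports.

Local Open Scope classical_set_scope.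
Local Open Scope card_scope.
Local Open Scope ring_scope.

(** * Walks and clusters *)

Section Walks.
Variable G : multigraph.
Implicit Types (F : set (edge G)) (x y z : vertex G) (w : seq (dart G)).

Lemma rev_dartK : involutive (@rev_dart G).
Proof. by case=> e b; rewrite /rev_dart /= negbK. Qed.

Lemma rev_dart_neq (a : dart G) : rev_dart a != a.
Proof. by case: a => e []; apply/eqP => -[]. Qed.

Lemma dtail_rev (a : dart G) : dtail (rev_dart a) = dhead a.
Proof. by case: a => e []. Qed.

Lemma dhead_rev (a : dart G) : dhead (rev_dart a) = dtail a.
Proof. by case: a => e []. Qed.

Lemma eq_rev_dart (a b : dart G) : (b == rev_dart a) = (rev_dart b == a).
Proof. by rewrite -(inj_eq (inv_inj rev_dartK)) rev_dartK. Qed.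

Lemma walk_cat x y z w w' : walk x w y -> walk y w' z -> walk x (w ++ w') z.
Proof. by elim: w x => [x -> //|a w IH x [<- /IH aw] /aw]. Qed.

Lemma walk_rev x y w : walk x w y -> walk y (rev (map (@rev_dart G) w)) x.
Proof.
elim: w x => [x -> //|a w IH x [<- /IH aw]] /=.
by rewrite rev_cons -cats1; apply: walk_cat aw _; rewrite /= dtail_rev dhead_rev.
Qed.

Lemma walk_in_cat F w w' :
  walk_in F w -> walk_in F w' -> walk_in F (w ++ w').
Proof. by move=> wF w'F a; rewrite mem_cat => /orP[/wF|/w'F]. Qed.

Lemma walk_in_rev F w : walk_in F w -> walk_in F (rev (map (@rev_dart G) w)).
Proof. by move=> wF a; rewrite mem_rev => /mapP[b /wF Fb ->]. Qed.

Lemma walk_in_cons F a w : walk_in F (a :: w) <-> F a.1 /\ walk_in F w.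
Proof.
split=> [aw|[Fa wF] b]; first split; first exact: aw (mem_head _ _).
  by move=> b bw; apply: aw; rewrite inE bw orbT.
by rewrite inE => /orP[/eqP ->|/wF].
Qed.

Lemma cluster_refl F x : cluster F x x.
Proof. by exists [::]. Qed.

Lemma cluster_trans F x y z : cluster F x y -> cluster F y z -> cluster F x z.
Proof.
move=> [w [xy wF]] [w' [yz w'F]]; exists (w ++ w').
by split; [exact: walk_cat yz|exact: walk_in_cat].
Qed.

Lemma cluster_sym F x y : cluster F x y -> cluster F y x.
Proof.
move=> [w [xy wF]]; exists (rev (map (@rev_dart G) w)).
by split; [exact: walk_rev|exact: walk_in_rev].
Qed.

Lemma cluster_dart F (a : dart G) : F a.1 -> cluster F (dtail a) (dhead a).
Proof. by move=> Fa; exists [:: a]; split => // b; rewrite inE => /eqP ->. Qed.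

Lemma cluster_edges_tail F x (a : dart G) :
  cluster_edges F x a.1 <-> F a.1 /\ cluster F x (dtail a).
Proof.
case: a => e []; first by [].
split=> -[Fe xe]; split => //; apply: cluster_trans xe _.
  exact: (cluster_dart (a := (e, true))).
exact: (cluster_dart (a := (e, false))).
Qed.

Lemma walk_in_cluster_edges F x w y :
  walk x w y -> walk_in F w -> walk_in (cluster_edges F x) w.
Proof.
suff gen z : cluster F z x -> walk x w y -> walk_in F w ->
    walk_in (cluster_edges F z) w by exact/gen/cluster_refl.
elim: w x => [//|a w IH] x zx [ax aw] /walk_in_cons[Fa wF].
apply/walk_in_cons; split; first by apply/cluster_edges_tail; rewrite ax.
by apply: IH aw wF; apply: cluster_trans zx _; rewrite -ax; apply: cluster_dart.
Qed.

Lemma finite_out_darts F x : locally_finite G -> finite_set (out_darts F x).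
Proof. by move=> /(_ x); apply: sub_finite_set => a []. Qed.

(** Local finiteness leaves finitely many walks of each length from x, even when the
graph is disconnected and uncountable. *)
Lemma countable_walks x : locally_finite G ->
  countable [set w | exists y, walk x w y].
Proof.
move=> lf.
have fin n z : finite_set [set w | size w = n /\ exists y, walk z w y].
  elim: n z => [|n IH] z.
    by apply: sub_finite_set (finite_set1 [::]) => w [/size0nil].
  apply: sub_finite_set (_ : finite_set (\bigcup_(a in out_darts setT z)
      (cons a @` [set w | size w = n /\ exists y, walk (dhead a) w y]))).
    move=> [[]//|a w] [/= [sw]] [y [az aw]]; exists a => //.
    by exists w => //; split => //; exists y.
  by apply: bigcup_finite => // a _; apply: finite_image; exact: IH.
rewrite (_ : mkset _ = \bigcup_(n in [set: nat])
    [set w | size w = n /\ exists y, walk x w y]).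
  by apply: bigcup_countable => // n _; exact/finite_set_countable.
by apply/seteqP; split=> [w ?|w [n _ []//]]; exists (size w).
Qed.

Lemma countable_edges (o : vertex G) : locally_finite G -> connected_graph G ->
  countable [set: edge G].
Proof.
move=> lf conn.
apply: (@sub_countable _ _ _ (\bigcup_(w in [set w | exists y, walk o w y])
   [set a.1 | a in [set` w]])); last first.
  apply: bigcup_countable; first exact: countable_walks.
  by move=> w _; apply/finite_set_countable/finite_image.
apply: subset_card_le => e _; have [w [ow _]] := conn o (src e).
exists (rcons w (e, true)); last by exists (e, true); rewrite //= mem_rcons mem_head.
by exists (tgt e); rewrite -cats1; apply: walk_cat ow _.
Qed.

End Walks.

(** * Flows along walks *)

Section WalkFlow.
Variables (R : realType) (G : multigraph).
Implicit Types (F : set (edge G)) (x y z : vertex G) (w : seq (dart G)).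
Implicit Types (theta : dart G -> R).

Lemma eq_divergence theta theta' x : theta =1 theta' ->
  divergence theta x = divergence theta' x.
Proof. by move=> eqt; apply: eq_fsbigr => a _. Qed.

Lemma divergenceD theta theta' x : locally_finite G ->
  divergence (fun a => theta a + theta' a) x =
  divergence theta x + divergence theta' x.
Proof. by move=> lf; rewrite /divergence fsbig_split. Qed.

Lemma divergenceZ (k : R) theta x :
  divergence (fun a => k * theta a) x = k * divergence theta x.
Proof. by rewrite /divergence mulr_fsumr. Qed.

Lemma unit_flow_divergence F o theta : unit_flow F o theta ->
  forall x, divergence theta x = (x == o)%:R.
Proof.
move=> [_ _ div1 div0] x.
by have [->|/eqP xo] := eqVneq x o; [exact: div1|exact: div0].
Qed.

(** Counting traversals makes this antisymmetric and additive under concatenation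
for every walk, whereas [path_flow] may fail both once an edge is traversed
twice; on self-avoiding walks the two agree ([path_flow_simple]). *)
Definition walk_flow w (a : dart G) : R :=
  (count_mem a w)%:R - (count_mem (rev_dart a) w)%:R.

(** Each dart adds the indicator of its tail and subtracts that of its head, so
along the walk the sum telescopes. *)
Lemma divergence_walk_flow x w y z : locally_finite G -> walk x w y ->
  divergence (walk_flow w) z = (z == x)%:R - (z == y)%:R.
Proof.
move=> lf; elim: w x => [|b w IH] x /=.
  by move=> ->; rewrite subrr /divergence fsbig1// => a _; rewrite /walk_flow subrr.
move=> [<- /IH bw].
rewrite (@eq_divergence _ (fun a => ((b == a)%:R - (b == rev_dart a)%:R)
    + walk_flow w a)); last first.
  by move=> a; rewrite /walk_flow /= !natrD opprD addrACA.
rewrite divergenceD// bw addrA; congr (_ - _).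
have point (c : dart G) : divergence (fun a => (c == a)%:R) z
    = (z == dtail c)%:R :> R.
  rewrite /divergence; have [->|zc] := eqVneq z (dtail c).
    rewrite (fsbigD1 c)//= eqxx fsbig1 ?addr0// => a /= [_ /eqP].
    by rewrite eq_sym => /negbTE ->.
  rewrite fsbig1// => a [az _]; case: eqP => // ca.
  by move: zc; rewrite -az ca eqxx.
rewrite divergenceD//.
rewrite (@eq_divergence (fun a => - _)
  (fun a => -1 * (rev_dart b == a)%:R)); last first.
  by move=> a; rewrite mulN1r eq_rev_dart.
by rewrite divergenceZ !point dtail_rev mulN1r addrNK.
Qed.

Lemma walk_flow_antisymmetric w : antisymmetric_flow (walk_flow w).
Proof. by move=> a; rewrite /walk_flow rev_dartK opprB. Qed.

(** Traversing an edge in both directions would visit one of its endpoints twice. *)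
Lemma simple_path_no_rev x w y a :
  simple_path x w y -> a \in w -> rev_dart a \notin w.
Proof.
move=> []; elim: w x => [//|b w IH] x [bx bw] /= /andP[xnw ubw].
rewrite !inE negb_or => /orP[/eqP ->|aw].
  rewrite rev_dart_neq /=; apply: contra xnw => rbw.
  by rewrite -bx -dhead_rev; apply/orP; right; exact: map_f.
rewrite (IH _ bw ubw aw) andbT; apply: contra xnw => /eqP rab.
rewrite -bx -rab dtail_rev; apply/orP; right; exact: map_f.
Qed.

Lemma simple_path_uniq x w y : simple_path x w y -> uniq w.
Proof. by case=> _ /= /andP[_ /map_uniq]. Qed.

Lemma path_flow_simple x w y : simple_path x w y -> path_flow R w =1 walk_flow w.
Proof.
move=> xwy a; rewrite /path_flow /walk_flow !count_uniq_mem ?(simple_path_uniq xwy)//.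
case: ifPn => [aw|_]; first by rewrite (negbTE (simple_path_no_rev xwy aw)) subr0.
by case: ifP; rewrite sub0r ?oppr0.
Qed.

End WalkFlow.

(** * Gauges *)

Section Gauge.
Variables (R : realType) (Phi : R -> R).
Hypothesis gPhi : gauge Phi.

Lemma gauge0 : Phi 0 = 0.
Proof. by case: gPhi. Qed.

Lemma gauge_le s t : 0 <= s -> s <= t -> Phi s <= Phi t.
Proof.
move=> s0; rewrite le_eqVlt => /predU1P[->//|st].
by case: gPhi => _ /(_ _ _ s0 st)/ltW.
Qed.

Lemma gauge_gt0 t : 0 < t -> 0 < Phi t.
Proof. by move=> t0; case: gPhi => P0 /(_ 0 t (lexx _) t0) + _; rewrite P0. Qed.

Lemma gauge_ge0 t : 0 <= t -> 0 <= Phi t.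
Proof. by move=> /(gauge_le (lexx 0)); rewrite gauge0. Qed.

Lemma gauge_convex a x y : 0 <= a <= 1 -> 0 <= x -> 0 <= y ->
  Phi (a * x + (1 - a) * y) <= a * Phi x + (1 - a) * Phi y.
Proof.
move=> a01 x0 y0; case: gPhi => _ _ cvx.
apply: (cvx (Itv01 (proj1 (andP a01)) (proj2 (andP a01))));
  by rewrite inE /= in_itv/= ?x0 ?y0.
Qed.

(** Jensen for the uniform average, multiplied by the number of terms: the term
joining the average enters with weight [1 / (n + 1)]. *)
Lemma gauge_jensen (I : Type) (s : seq I) (x : I -> R) :
  (forall i, 0 <= x i) -> (0 < size s)%N ->
  (size s)%:R * Phi ((\sum_(i <- s) x i) / (size s)%:R) <= \sum_(i <- s) Phi (x i).
Proof.
move=> x0; elim: s => [//|i s IH] _.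
have [/size0nil ->|s0] := posnP (size s).
  by rewrite !big_seq1 /= mul1r divr1.
rewrite !big_cons /=; set n : R := (size s)%:R; set S := \sum_(j <- s) x j.
have n0 : 0 < n by rewrite ltr0n.
have S0 : 0 <= S by apply: sumr_ge0.
have n1 : (size s).+1%:R = n + 1 :> R by rewrite -natr1.
have n10 : 0 < n + 1 by rewrite addr_gt0.
rewrite n1 -[X in Phi X](_ : (n + 1)^-1 * x i
  + (1 - (n + 1)^-1) * (S / n) = _); last first.
  by field; rewrite !gt_eqF.
apply: (@le_trans _ _ (Phi (x i) + n * Phi (S / n))); last by rewrite lerD2l IH.
rewrite -ler_pdivlMl//; apply: le_trans (gauge_convex _ _ _) _ => //.
- by rewrite invr_ge0 ltW//= invf_le1// lerDr ltW.
- by rewrite divr_ge0// ltW.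
- rewrite le_eqVlt; apply/orP; left; apply/eqP; by field; rewrite gt_eqF.
Qed.

(** Slopes of a convex function increase, so the slope from s to t is at most the
slope from t to T + 1, whose run is at least 1.  This bounds Phi in Lipschitz
fashion up to T, the endpoint 0 included. *)
Lemma gauge_chord s t : 0 <= s <= t -> forall T, t <= T ->
  Phi t - Phi s <= (t - s) * Phi (T + 1).
Proof.
move=> /andP[s0 st] T tT.
pose a := (T + 1 - t) / (T + 1 - s).
have d0 : 0 < T + 1 - s by lra.
have a01 : 0 <= a <= 1.
  by rewrite /a divr_ge0 ?(ltW d0)//= ?ler_pdivrMr ?mul1r; lra.
have e : t = a * s + (1 - a) * (T + 1) by rewrite /a; field; rewrite gt_eqF.
have T0 : 0 <= T + 1 by lra.
have := gauge_convex a01 s0 T0; rewrite -e => le_t.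
have Ps := gauge_ge0 s0; have PT := gauge_ge0 T0.
have a1 : 1 - a <= t - s.
  rewrite (_ : 1 - a = (t - s) / (T + 1 - s)); last first.
    by rewrite /a; field; rewrite gt_eqF.
  by rewrite ler_pdivrMr// ler_peMr; lra.
have := ler_wpM2r PT a1.
have := mulr_ge0 (_ : 0 <= 1 - a) Ps.
have -> : 0 <= 1 - a by lra.
move=> /(_ isT).
lra.
Qed.

Lemma gauge_norm_continuous : continuous (fun t : R => Phi `|t|).
Proof.
move=> t; apply/cvgrPdist_le => /= e e0.
pose C := Phi (`|t| + 2) + 1.
have C0 : 0 < C by rewrite /C ltr_wpDl// gauge_ge0// addr_ge0.
near=> u.
have ut : `|t - u| <= 1 by near: u; apply: cvgr_dist_le.
have ue : `|t - u| <= e / C by near: u; apply: cvgr_dist_le => //; rewrite divr_gt0.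
apply: (@le_trans _ _ (`|t - u| * C)); last by rewrite -ler_pdivlMr.
have tu : `| `|t| - `|u| | <= `|t - u| by exact: ler_dist_dist.
have bound s' t' : 0 <= s' <= t' -> t' <= `|t| + 1 -> Phi t' - Phi s' <= (t' - s') * C.
  move=> st' le_t; apply: le_trans (gauge_chord st' le_t) _.
  apply: ler_wpM2l; first by case/andP: st' => _; rewrite subr_ge0.
  by rewrite /C -addrA lerDl.
have u0 := normr_ge0 u; have t0 := normr_ge0 t.
have C0' := ltW C0.
have [tu'|ut'] := leP `|t| `|u|.
  rewrite distrC ger0_norm ?subr_ge0 ?gauge_le//.
  apply: le_trans (bound _ _ _ _) _; rewrite ?t0 ?tu'//.
    by move: tu; rewrite distrC ger0_norm ?subr_ge0//; lra.
  by rewrite ler_wpM2r//; apply: le_trans tu; rewrite distrC ler_norm.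
rewrite ger0_norm ?subr_ge0 ?gauge_le ?(ltW ut')//.
apply: le_trans (bound _ _ _ _) _; rewrite ?u0 ?(ltW ut')//; first by lra.
by rewrite ler_wpM2r//; apply: le_trans tu; rewrite ler_norm.
Unshelve. all: by end_near. Qed.

(** A convex function vanishing at 0 grows at least linearly beyond 1, so an energy
bound bounds the flow on every edge. *)
Lemma gauge_bounded M t : 0 <= t -> Phi t <= M -> t <= 1 + M / Phi 1.
Proof.
move=> t0 tM; have P1 := gauge_gt0 ltr01.
have M0 : 0 <= M by apply: le_trans tM; exact: gauge_ge0.
have [t1|t1] := leP t 1.
  by apply: le_trans t1 _; rewrite lerDl divr_ge0// ltW.
suff : t * Phi 1 <= M.
  by rewrite -ler_pdivlMr// => /le_trans; apply; rewrite lerDr.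
apply: le_trans tM; rewrite mulrC -ler_pdivlMr; last exact: lt_trans t1.
have ti : 0 <= t^-1 <= 1 by rewrite invr_ge0 t0 invf_le1 ?(ltW t1)//; exact: lt_trans t1.
have := gauge_convex ti t0 (lexx 0).
by rewrite gauge0 !mulr0 !addr0 mulVf ?gt_eqF ?(lt_trans ltr01)// mulrC.
Qed.

(** For later estimates beta enters only as a finite real constant [b] for which
[Phi (m * t) <= b * m * Phi t]. *)
Lemma gauge_betaP (K : nat) : (1 <= K)%N ->
  (forall m, (1 <= m <= K)%N -> (gauge_alpha Phi m < +oo)%E) ->
  exists b : R, [/\ 0 <= b, gauge_beta Phi K = b%:E &
    forall m t, (1 <= m <= K)%N -> 0 <= t -> Phi (m%:R * t) <= b * m%:R * Phi t].
Proof.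
move=> K1 afin.
have ratio m t : (1 <= m <= K)%N -> 0 < t ->
    ((Phi (m%:R * t) / Phi t / m%:R)%:E <= gauge_beta Phi K)%E.
  move=> mK t0; have m0 : 0 < m%:R :> R by rewrite ltr0n; case/andP: mK.
  apply: (@bigmax_sup_seq _ _ _ _ _ m); rewrite ?mem_index_iota ?ltnS//.
  rewrite EFinM lee_pmul2r// ?lte_fin ?invr_gt0//.
  by apply: ereal_sup_ubound; exists t.
(* The term m = 1 is at least 1; this excludes the value -oo and gives 0 <= b. *)
have beta_ge : (1%:E <= gauge_beta Phi K)%E.
  apply: le_trans (ratio 1%N 1 _ ltr01); last by rewrite K1.
  by rewrite mul1r divr1 divff ?gt_eqF// gauge_gt0.
have beta_lt : (gauge_beta Phi K < +oo)%E.
  rewrite /gauge_beta big_nat; apply: (big_ind (fun x => (x < +oo)%E)) => //.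
    by move=> x y x1 y1; rewrite gt_max x1.
  move=> m mK; have m0 : 0 < m%:R :> R by rewrite ltr0n; case/andP: mK.
  have := afin _ mK; case: (gauge_alpha Phi m) => [a _|//|_].
    by rewrite -EFinM ltry.
  by rewrite mulNyr gtr0_sg ?invr_gt0// mul1e.
case: (gauge_beta Phi K) ratio beta_ge beta_lt => [b|//|//] ratio b1 _.
exists b; split => //; first by apply: le_trans ler01 _; rewrite lee_fin in b1.
move=> m t mK; rewrite le_eqVlt => /predU1P[<-|t0].
  by rewrite mulr0 gauge0 mulr0.
have m0 : 0 < m%:R :> R by rewrite ltr0n; case/andP: mK.
have := ratio _ _ mK t0; rewrite lee_fin ler_pdivrMr// ler_pdivrMr//.
exact: gauge_gt0.
Qed.

(** Write the sum of the absolute values as m times their average: beta controls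
the dilation by m and Jensen the average. *)
Lemma gauge_sum_le (I : Type) (s : seq I) (x : I -> R) (K : nat) (b : R) :
  (forall m t, (1 <= m <= K)%N -> 0 <= t -> Phi (m%:R * t) <= b * m%:R * Phi t) ->
  0 <= b -> (size s <= K)%N ->
  Phi `|\sum_(i <- s) x i| <= b * \sum_(i <- s) Phi `|x i|.
Proof.
move=> bP b0 sK; have [/size0nil ->|s0] := posnP (size s).
  by rewrite !big_nil normr0 gauge0 mulr0.
have n0 : 0 < (size s)%:R :> R by rewrite ltr0n.
apply: (@le_trans _ _ (Phi (\sum_(i <- s) `|x i|))).
  by apply: gauge_le => //; exact: ler_norm_sum.
rewrite -[X in Phi X](mulfVK (lt0r_neq0 n0)) mulrC.
apply: le_trans (bP _ _ _ _) _; rewrite ?s0 ?divr_ge0 ?sumr_ge0//.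
by rewrite -mulrA ler_wpM2l// gauge_jensen.
Qed.

End Gauge.

(** * Lifting a flow along routes *)

Section ESum.
Variables (R : realType).

Lemma esum_mulr_le (T : choiceType) (D : set T) (c : R) (a : T -> R) :
  0 <= c -> (forall i, D i -> 0 <= a i) ->
  (\esum_(i in D) (c * a i)%:E <= c%:E * \esum_(i in D) (a i)%:E)%E.
Proof.
move=> c0 a0; apply: ge_ereal_sup => _ [A [finA AD] <-].
rewrite fsumEFin// -mulr_fsumr EFinM lee_wpmul2l ?lee_fin//.
by apply: esum_ge; exists A => //; rewrite fsumEFin.
Qed.

(** Both sides sum the nonnegative [a] over the pairs related by [r]. *)
Lemma exchange_esum (S T : choiceType) (D : set S) (r : S -> T -> Prop)
    (a : S -> \bar R) : (forall s, (0 <= a s)%E) ->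
  \esum_(t in [set: T]) \esum_(s in [set s | D s /\ r s t]) a s =
  \esum_(s in D) \esum_(t in [set t | r s t]) a s.
Proof.
move=> a0; rewrite !esum_esum//.
rewrite (@reindex_esum _ _ _ (D `*`` (fun s => [set t | r s t])) _
  (fun k => (k.2, k.1)))//.
split.
- by move=> [s t] [Ds rst].
- by move=> [s t] [s' t'] _ _ [-> ->].
- by move=> [t s] [_ [/= Ds rst]]; exists (s, t).
Qed.

Lemma esum_subset_le (T : choiceType) (D D' : set T) (a : T -> \bar R) :
  D `<=` D' -> (\esum_(i in D) a i <= \esum_(i in D') a i)%E.
Proof.
move=> DD'; apply: ereal_sup_le => _ [A [finA AD] <-].
by exists A => //; split=> // i /AD/DD'.
Qed.

End ESum.

Section Divergence.
Variables (R : realType) (G : multigraph) (D : set (edge G)) (theta : dart G -> R).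
Hypothesis lf : locally_finite G.
Hypothesis anti : antisymmetric_flow theta.
Hypothesis supp : forall a, ~ D a.1 -> theta a = 0.

(** The darts leaving x are the edges starting at x and the reversed edges ending
at x.  Indexing by edges makes this formula comparable with [divergence_lift]. *)
Lemma divergence_edges x : divergence theta x =
  \sum_(e \in D) theta (e, true) * ((x == src e)%:R - (x == tgt e)%:R).
Proof.
pose S := [set e | D e /\ src e = x]; pose T := [set e | D e /\ tgt e = x].
have finfst := finite_image fst (lf x).
have finS : finite_set S.
  by apply: sub_finite_set finfst => e [_ ex]; exists (e, true).
have finT : finite_set T.
  by apply: sub_finite_set finfst => e [_ ex]; exists (e, false).
have finST : finite_set (S `|` T) by rewrite finite_setU.
rewrite -[RHS](fsbig_widen (S `|` T)); last 2 first.
- by move=> e [[]|[]].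
- move=> e [De /not_orP[nS nT]] /=.
  case: eqP => [xe|_]; first by case: nS.
  by case: eqP => [xe|_]; [case: nT|rewrite subrr mulr0].
under eq_fsbigr do rewrite mulrBr -mulrN.
rewrite fsbig_split//.
rewrite -[X in _ = X + _](fsbig_widen S); last 2 first.
- by move=> e; left.
- move=> e [ST nS] /=; case: eqP => [xe|_]; last by rewrite mulr0.
  by case: nS; case: ST => // -[De _].
rewrite -[X in _ = _ + X](fsbig_widen T); last 2 first.
- by move=> e; right.
- move=> e [ST nT] /=; case: eqP => [xe|_]; last by rewrite oppr0 mulr0.
  by case: nT; case: ST => // -[De _].
rewrite /divergence -(fsbig_widen ((fun e => (e, true)) @` S `|`
   (fun e => (e, false)) @` T)); last 2 first.
- by move=> a [] [e [De ex] <-].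
- move=> [e b] [/= [eb _] /not_orP[nS nT]]; apply: supp => /= De.
  by case: b nS nT eb => nS nT eb; [apply: nS|apply: nT]; exists e.
rewrite fsbigU0 ?fsbig_image; last first.
- by move=> a [[e _ <-] [f _]].
- exact: finite_image.
- exact: finite_image.
- by move=> e f _ _ [].
- by move=> e f _ _ [].
congr (_ + _); apply: eq_fsbigr => e /set_mem[De <-]; rewrite eqxx.
  by rewrite mulr1.
by rewrite mulrN1 -(anti (e, true)).
Qed.

End Divergence.

Section Lift.
Variables (R : realType) (B H : multigraph) (M : repair_model B H).
Variables (D : set (edge B)) (g : edge B -> seq (dart H)) (L K : nat).
Hypothesis lfB : locally_finite B.
Hypothesis lfH : locally_finite H.
Hypothesis gpath : forall e, D e ->
  simple_path (site M (src e)) (g e) (site M (tgt e)).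
Hypothesis ctl : controlled L K D g.

Definition users (f : edge H) : set (edge B) :=
  [set e | D e /\ exists2 a, a \in g e & a.1 = f].

Lemma finite_users f : finite_set (users f).
Proof. by apply/finite_set_leP; exists K; case: ctl => _; apply. Qed.

Lemma path_flow_users e a : D e -> ~ users a.1 e -> path_flow R (g e) a = 0.
Proof.
move=> De nu; rewrite /path_flow; case: ifPn => [ae|_].
  by case: nu; split => //; exists a.
by case: ifPn => // ae; case: nu; split => //; exists (rev_dart a).
Qed.

Variable theta : dart B -> R.

Lemma lift_flowE (A : set (edge B)) a : users a.1 `<=` A -> A `<=` D ->
  lift_flow D g theta a = \sum_(e \in A) theta (e, true) * path_flow R (g e) a.
Proof.
move=> uA AD; rewrite /lift_flow -(fsbig_widen A)// => e [De nA] /=.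
by rewrite path_flow_users ?mulr0// => /uA.
Qed.

Lemma lift_flow_antisymmetric : antisymmetric_flow (lift_flow D g theta).
Proof.
move=> a; rewrite -mulN1r /lift_flow mulr_fsumr; apply: eq_fsbigr => e /set_mem De.
rewrite !(path_flow_simple R (gpath De)) (@walk_flow_antisymmetric R).
by rewrite mulrN mulN1r.
Qed.

(** Only the routes through the finitely many edges at z matter there, so the sums
over routes and over darts at z may be exchanged; what remains is the divergence
of each path flow. *)
Lemma divergence_lift z : divergence (lift_flow D g theta) z =
  \sum_(e \in D) theta (e, true) *
     ((z == site M (src e))%:R - (z == site M (tgt e))%:R).
Proof.
pose A := \bigcup_(a in out_darts setT z) users a.1.
have finA : finite_set A.
  by apply: bigcup_finite => // a _; exact: finite_users.
have AD : A `<=` D by move=> e [a _ []].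
transitivity (\sum_(a \in out_darts setT z) \sum_(e \in A)
    theta (e, true) * path_flow R (g e) a).
  apply: eq_fsbigr => a /set_mem az; apply: lift_flowE => // e ae.
  by exists a.
rewrite exchange_fsbig//.
have divD e : D e -> \sum_(a \in out_darts setT z) theta (e, true) *
    path_flow R (g e) a = theta (e, true) *
     ((z == site M (src e))%:R - (z == site M (tgt e))%:R).
  move=> De; rewrite -mulr_fsumr; congr (_ * _).
  rewrite -(divergence_walk_flow _ _ lfH (proj1 (gpath De))).
  exact/eq_divergence/path_flow_simple/(gpath De).
rewrite (fsbig_widen A D)//.
  by apply: eq_fsbigr => e /set_mem; exact: divD.
move=> e [De nA] /=; apply: fsbig1 => a az.
by rewrite path_flow_users ?mulr0// => ue; apply: nA; exists a.
Qed.

(** Since the site map is injective, [divergence_lift] at a site is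
[divergence_edges] at the corresponding demand vertex, and it vanishes off the
sites.  Following routes in place of demand edges connects every used physical
edge to the site of o. *)
Lemma unit_flow_lift S o : unit_flow D o theta ->
  (forall e, D e -> walk_in S (g e)) -> D `<=` cluster_edges D o ->
  unit_flow (cluster_edges S (site M o)) (site M o) (lift_flow D g theta).
Proof.
move=> uf gS Do; have div_theta := unit_flow_divergence uf.
have [anti supp _ _] := uf.
have div_site x : divergence (lift_flow D g theta) (site M x) = (x == o)%:R.
  rewrite divergence_lift -div_theta (divergence_edges lfB anti supp).
  by apply: eq_fsbigr => e _; rewrite !(inj_eq (@site_inj _ _ M)).
split.
- exact: lift_flow_antisymmetric.
- move=> a na; rewrite (@lift_flowE set0) ?fsbig_set0// => e [De [b be eb]].
  apply: na; rewrite -eb.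
  have [w [ow wD]] := (Do _ De).2.
  have : cluster S (site M o) (site M (src e)).
    elim: w (o) ow wD => [x -> _|c w IH x [<- cw] /walk_in_cons[Dc wD]].
      exact: cluster_refl.
    apply: cluster_trans (IH _ cw wD).
    have : cluster S (site M (src c.1)) (site M (tgt c.1)).
      by exists (g c.1); split; [exact: (gpath Dc).1|exact: gS].
    by rewrite /dtail /dhead; case: c.2 => //; exact: cluster_sym.
  have /(walk_in_cluster_edges (gpath De).1)/(_ _ be)[Sb eb'] := gS _ De.
  by move=> /cluster_trans /(_ eb').
- by rewrite div_site eqxx.
- move=> z zo; have [[x xz]|nz] := pselect (exists x, site M x = z).
    by rewrite -xz div_site; case: eqP => // xo; case: zo; rewrite -xz xo.
  rewrite divergence_lift fsbig1// => e _.
  case: eqP => [ze|_]; first by case: nz; exists (src e).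
  by case: eqP => [ze|_]; [case: nz; exists (tgt e)|rewrite subrr mulr0].
Qed.

Variables (Phi : R -> R) (b : R).
Hypothesis gPhi : gauge Phi.
Hypothesis b0 : 0 <= b.
Hypothesis bP : forall m t, (1 <= m <= K)%N -> 0 <= t ->
  Phi (m%:R * t) <= b * m%:R * Phi t.

Lemma norm_path_flow_le1 w (a : dart H) : `|path_flow R w a| <= 1.
Proof.
by rewrite /path_flow; case: ifP => _; [|case: ifP => _];
  rewrite ?normrN ?normr1 ?normr0.
Qed.

Lemma gauge_lift_flow_le a : Phi `|lift_flow D g theta a| <=
  \sum_(e \in users a.1) b * Phi `|theta (e, true)|.
Proof.
have fin := finite_users a.1.
have uD : users a.1 `<=` D by move=> e [].
rewrite (lift_flowE _ uD)// -mulr_fsumr !fsbig_finite//.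
apply: le_trans (gauge_sum_le gPhi _ bP b0 _) _.
  by apply: geq_card_fset_set; case: ctl => _; apply.
rewrite ler_wpM2l// ler_sum// => e _; apply: gauge_le => //.
by rewrite normrM ler_piMr// norm_path_flow_le1.
Qed.

Lemma esum_route_le (w : seq (dart H)) (c : R) : (size w <= L)%N -> 0 <= c ->
  (\esum_(f in [set f | exists2 a, a \in w & a.1 = f]) c%:E <= (L%:R * c)%:E)%E.
Proof.
move=> wL c0.
have -> : [set f | exists2 a, a \in w & a.1 = f] = [set` undup (map fst w)].
  apply/seteqP; split=> f; rewrite /= mem_undup.
    by move=> [a aw <-]; exact: map_f.
  by move=> /mapP[a aw ->]; exists a.
rewrite esum_fset// fsumEFin// -fsbig_seq ?undup_uniq// big_const_seq count_predT.
rewrite iter_addr_0 lee_fin -[c *+ _]mulr_natl ler_wpM2r// ler_nat.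
by rewrite (leq_trans (size_undup _))// size_map.
Qed.

(** Each physical edge charges its energy to the routes through it at the rate b,
and each demand edge is charged at most L times. *)
Lemma energy_lift :
  (energy Phi setT (lift_flow D g theta) <= L%:R%:E * b%:E * energy Phi D theta)%E.
Proof.
pose c e := b * Phi `|theta (e, true)|.
have c0 e : 0 <= c e by rewrite mulr_ge0// gauge_ge0.
apply: (@le_trans _ _ (\esum_(f in [set: edge H])
    \esum_(e in users f) (c e)%:E)%E).
  apply: le_esum => f _; rewrite esum_fset; last 2 first.
  - exact: finite_users.
  - by move=> e _; rewrite lee_fin.
  by rewrite fsumEFin ?lee_fin; [exact: gauge_lift_flow_le|exact: finite_users].
rewrite exchange_esum; last by move=> e; rewrite lee_fin.
apply: (@le_trans _ _ (\esum_(e in D) (L%:R * b * Phi `|theta (e, true)|)%:E)%E).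
  apply: le_esum => e De; rewrite -mulrA; apply: esum_route_le => //.
  by case: ctl => + _; apply.
rewrite -EFinM; apply: esum_mulr_le; first by rewrite mulr_ge0.
by move=> e _; rewrite gauge_ge0.
Qed.

End Lift.

(** * Transience from a flow of finite quadratic energy *)

Section Transience.
Variables (R : realType) (G : multigraph) (F : set (edge G)).
Hypothesis lf : locally_finite G.
Implicit Types (f h : vertex G -> R) (x y : vertex G) (theta : dart G -> R).

Local Notation sq := (fun t : R => t ^+ 2).

Definition degree y : R := \sum_(a \in out_darts F y) (1 : R).

Definition laplacian f y : R := \sum_(a \in out_darts F y) (f y - f (dhead a)).

Lemma degree_ge0 y : 0 <= degree y.
Proof. exact: fsumr_ge0. Qed.

Lemma degree_eq0 y : degree y = 0 -> out_darts F y = set0.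
Proof.
move=> d0; rewrite -subset0 => a ya.
have := pfsumr_eq0 (finite_out_darts F y lf) (fun _ _ => ler01) d0 ya.
by move/eqP; rewrite oner_eq0.
Qed.

Lemma walk_averageE f y : walk_average F f y =
  if degree y == 0 then f y
  else (\sum_(a \in out_darts F y) f (dhead a)) / degree y.
Proof. by []. Qed.

(** At an isolated vertex both sides vanish because the degree is 0, so the value
given to the average there does not matter. *)
Lemma laplacianE f y : laplacian f y = degree y * (f y - walk_average F f y).
Proof.
have fin := finite_out_darts F y lf; rewrite walk_averageE /laplacian.
case: eqP => [d0|/eqP d0].
  by rewrite d0 mul0r (degree_eq0 d0) fsbig_set0.
rewrite mulrBr mulrCA divff// mulr1.
rewrite fsbig_split//= /degree mulr_fsuml; congr (_ + _).
  by apply: eq_fsbigr => a _; rewrite mul1r.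
by rewrite -mulN1r mulr_fsumr; apply: eq_fsbigr => a _; rewrite mulN1r.
Qed.

Lemma walk_average_le f h y : (forall z, f z <= h z) ->
  walk_average F f y <= walk_average F h y.
Proof.
move=> fh; rewrite !walk_averageE; case: ifP => // _.
rewrite ler_wpM2r ?invr_ge0 ?degree_ge0// !fsbig_finite; try exact: finite_out_darts.
exact: ler_sum.
Qed.

Lemma hit_prob_root x n : hit_prob R F x n x = 1.
Proof. by case: n => [|n] /=; rewrite eqxx. Qed.

Lemma hit_probS x n y : y != x ->
  hit_prob R F x n.+1 y = walk_average F (hit_prob R F x n) y.
Proof. by move=> /negbTE /= ->. Qed.

Lemma hit_prob_ge0 x n y : 0 <= hit_prob R F x n y.
Proof.
elim: n y => [|n IH] y /=; case: ifP => // _.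
rewrite walk_averageE; case: ifP => // _.
by rewrite divr_ge0 ?degree_ge0// fsumr_ge0.
Qed.

Lemma hit_prob_nondecreasing x n y : hit_prob R F x n y <= hit_prob R F x n.+1 y.
Proof.
elim: n y => [|n IH] y; have [->|yx] := eqVneq y x; rewrite ?hit_prob_root//.
  by have := hit_prob_ge0 x 1 y; rewrite /= (negbTE yx).
by rewrite !hit_probS//; exact: walk_average_le.
Qed.

Lemma hit_prob_finite_support x n : finite_set [set y | hit_prob R F x n y != 0].
Proof.
elim: n => [|n IH].
  apply: sub_finite_set (finite_set1 x) => y /=.
  by have [//|_] := eqVneq y x; rewrite eqxx.
pose S := [set y | hit_prob R F x n y != 0].
apply: (@sub_finite_set _ _ (x |` (S `|`
   \bigcup_(z in S) (@dhead G @` out_darts setT z)))).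
  move=> y /=; have [->|yx] := eqVneq y x; first by left.
  rewrite walk_averageE; case: ifP => [_ Sy|_ avg0]; right; first by left.
  right; apply: contrapT => nS; move: avg0; rewrite fsbig1 ?mul0r ?eqxx// => a [ya Fa].
  apply: contrapT => ha; apply: nS; exists (dhead a); first exact/eqP.
  by exists (rev_dart a); rewrite ?dhead_rev//; split => //; exact: dtail_rev.
rewrite !finite_setU; split; [exact: finite_set1|split => //].
by apply: bigcup_finite => // z _; exact: finite_image.
Qed.

(** Off x the average of the n-step hitting probability is the one for n + 1 steps,
which is at least as large. *)
Lemma laplacian_hit_prob_le0 x n y : y != x ->
  laplacian (hit_prob R F x n) y <= 0.
Proof.
move=> yx; rewrite laplacianE -hit_probS//.
by rewrite mulr_ge0_le0 ?degree_ge0// subr_le0 hit_prob_nondecreasing.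
Qed.

Lemma sum_darts (N : set (edge G)) (phi : dart G -> R) : finite_set N ->
  \sum_(a \in N `*` setT) phi a = \sum_(e \in N) (phi (e, true) + phi (e, false)).
Proof.
move=> finN.
have setb : [set: bool] = [set` [:: true; false]].
  by apply/seteqP; split=> // -[].
have finb : finite_set [set: bool] by rewrite setb.
transitivity (\sum_(a \in N `*` setT) phi (a.1, a.2)).
  by apply: eq_fsbigr => -[].
rewrite -(@pair_fsbig _ _ _ _ _ N setT (fun e b => phi (e, b)))//.
by apply: eq_fsbigr => e _; rewrite setb -fsbig_seq// !big_cons big_nil /= addr0.
Qed.

Definition incident_edges (S : set (vertex G)) : set (edge G) :=
  [set e | F e /\ (S (src e) \/ S (tgt e))].

Lemma finite_incident_edges S : finite_set S -> finite_set (incident_edges S).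
Proof.
move=> finS.
apply: (@sub_finite_set _ _ (fst @` \bigcup_(y in S) out_darts setT y)).
  move=> e [Fe [Se|Se]]; first by exists (e, true) => //; exists (src e).
  by exists (e, false) => //; exists (tgt e).
by apply: finite_image; apply: bigcup_finite.
Qed.

(** Reversing darts exchanges the head and tail contributions up to the sign
of [psi], which yields the factor 2; grouping by tails then gives the right-hand
side.  Restricting to the edges that meet the finite support of [f] loses
nothing and makes every sum finite. *)
Lemma summation_by_parts f (psi : dart G -> R) (S : set (vertex G)) :
  finite_set S -> (forall y, ~ S y -> f y = 0) ->
  (forall a, psi (rev_dart a) = - psi a) ->
  \sum_(a \in incident_edges S `*` setT)
      psi a * (f (dtail a) - f (dhead a)) =
  2 * \sum_(y \in S) f y * \sum_(a \in out_darts F y) psi a.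
Proof.
move=> finS fS anti; set N := incident_edges S; set A := N `*` setT.
have finN : finite_set N := finite_incident_edges finS.
have finA : finite_set A by apply: finite_setX => //; exact: finite_finset.
transitivity (2 * \sum_(a \in A) psi a * f (dtail a)).
  rewrite /A !sum_darts// mulr_fsumr; apply: eq_fsbigr => e _.
  by rewrite (anti (e, true)) /dtail /dhead /=; ring.
congr (2 * _).
transitivity (\sum_(a \in A) \sum_(y \in S) psi a * f y * (dtail a == y)%:R).
  apply: eq_fsbigr => a _; have [St|St] := pselect (S (dtail a)).
    rewrite -(fsbig_widen [set dtail a]) ?fsbig_set1 ?eqxx ?mulr1//.
      by move=> y ->.
    by move=> y [_ /= /eqP ya]; rewrite eq_sym (negbTE ya) mulr0.
  rewrite fS// mulr0 fsbig1// => y Sy; case: eqP => [ay|_]; last by rewrite mulr0.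
  by case: St; rewrite ay.
rewrite exchange_fsbig//; apply: eq_fsbigr => y /set_mem Sy.
rewrite mulr_fsumr -(fsbig_widen (out_darts F y) A).
- by apply: eq_fsbigr => a /set_mem[-> _]; rewrite eqxx mulr1 mulrC.
- move=> a [ay Fa]; split => //; split => //.
  by move: ay Sy; rewrite /dtail; case: a.2 => <-; [left|right].
- move=> a [[[Fa _] _] na] /=; case: eqP => [ay|_]; last by rewrite mulr0.
  by case: na.
Qed.

(** With [df] the gradient of the hitting probability and E the energy of the flow,
summation by parts evaluates the sum over darts of [theta * df] to 2 and bounds
that of [df ^+ 2] by twice the Laplacian at x.  Expanding the nonnegative sum of
[(u * theta - df) ^+ 2] gives [2 * u - E * u ^+ 2 <=] Laplacian for every u; the
value [u = 1 / (E + 1)] is near the optimal [1 / E] and makes sense when [E = 0]. *)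
Lemma laplacian_hit_prob_ge x n (theta : dart G -> R) (E : R) : unit_flow F x theta ->
  (energy sq setT theta <= E%:E)%E ->
  (E + 1)^-1 <= laplacian (hit_prob R F x n) x.
Proof.
move=> uf leE; have [anti supp _ _] := uf.
have divF y : \sum_(a \in out_darts F y) theta a = (y == x)%:R.
  rewrite -(unit_flow_divergence uf) /divergence; apply: fsbig_widen.
    by move=> a [].
  by move=> a [[ya _] na]; apply: supp => Fa; apply: na.
set f := hit_prob R F x n; set S := [set y | f y != 0].
have finS : finite_set S by exact: hit_prob_finite_support.
have fS y : ~ S y -> f y = 0 by move=> /negP; rewrite negbK => /eqP.
have fx : f x = 1 by exact: hit_prob_root.
have Sx : S x by rewrite /S /= fx oner_eq0.
pose df (a : dart G) := f (dtail a) - f (dhead a).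
have df_anti a : df (rev_dart a) = - df a.
  by rewrite /df dtail_rev dhead_rev opprB.
have := summation_by_parts finS fS anti; set N := incident_edges S.
have := summation_by_parts finS fS df_anti; rewrite -/N.
have finN : finite_set N := finite_incident_edges finS.
rewrite -/df => sum_df.
have -> : \sum_(y \in S) f y * (\sum_(a \in out_darts F y) theta a) = 1.
  rewrite -(fsbig_widen [set x]) ?fsbig_set1 ?divF ?fx ?eqxx ?mulr1//.
    by move=> y ->.
  by move=> y [_ /= /eqP yx]; rewrite divF (negbTE yx) mulr0.
rewrite mulr1 => sum_theta.
have le_lap : \sum_(y \in S) f y * (\sum_(a \in out_darts F y) df a)
    <= laplacian f x.
  rewrite (fsbigD1 x)//= fx mul1r.
  have -> : \sum_(a \in out_darts F x) df a = laplacian f x.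
    by apply: eq_fsbigr => a /set_mem[<-].
  rewrite gerDl; apply: fsumr_le0 => y [Sy /= /eqP yx].
  rewrite mulr_ge0_le0 ?hit_prob_ge0//.
  suff -> : \sum_(a \in out_darts F y) df a = laplacian f y.
    exact: laplacian_hit_prob_le0.
  by apply: eq_fsbigr => a /set_mem[<-].
have le_theta : \sum_(a \in N `*` setT) theta a ^+ 2 <= 2 * E.
  rewrite sum_darts//.
  have -> : \sum_(e \in N) (theta (e, true) ^+ 2 + theta (e, false) ^+ 2) =
      2 * \sum_(e \in N) `|theta (e, true)| ^+ 2.
    rewrite mulr_fsumr; apply: eq_fsbigr => e _.
    by rewrite real_normK ?num_real// (anti (e, true)); ring.
  rewrite ler_wpM2l// -lee_fin; apply: le_trans leE; apply: esum_ge.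
  by exists N => //; rewrite fsumEFin.
have E0 : 0 <= E.
  by rewrite -lee_fin; apply: le_trans leE; apply: esum_ge0 => e _; rewrite lee_fin sqr_ge0.
(* E may vanish, hence the shift by 1. *)
pose u := (E + 1)^-1; have u0 : 0 < u by rewrite invr_gt0; lra.
have uE : u * (E + 1) = 1 by rewrite mulVf// gt_eqF//; lra.
rewrite -/u; move: u u0 uE => u u0 uE.
have : 0 <= \sum_(a \in N `*` setT) (u * theta a - df a) ^+ 2.
  by apply: fsumr_ge0 => a _; exact: sqr_ge0.
have -> : \sum_(a \in N `*` setT) (u * theta a - df a) ^+ 2 =
    u ^+ 2 * (\sum_(a \in N `*` setT) theta a ^+ 2)
    + - (2 * u) * (\sum_(a \in N `*` setT) theta a * df a)
    + \sum_(a \in N `*` setT) df a * df a.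
  rewrite !mulr_fsumr -!fsbig_split//=; try by apply: finite_setX => //; exact: finite_finset.
  by apply: eq_fsbigr => a _; ring.
rewrite sum_theta sum_df => ge0.
have u2 : u ^+ 2 * (\sum_(a \in N `*` setT) theta a ^+ 2) <= u ^+ 2 * (2 * E).
  by rewrite ler_wpM2l// sqr_ge0.
have u2E : u ^+ 2 * (2 * E) = 2 * u - 2 * u ^+ 2.
  have -> : u ^+ 2 * (2 * E) = 2 * u * (u * (E + 1)) - 2 * u ^+ 2 by ring.
  by rewrite uE mulr1.
have := sqr_ge0 u.
lra.
Qed.

(** The Laplacian at x is the degree times the probability of not returning within
n + 1 steps, so its lower bound is uniform in n and survives the supremum. *)
Lemma return_prob_lt1 x theta : unit_flow F x theta ->
  (energy sq setT theta < +oo)%E -> return_prob R F x < 1.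
Proof.
move=> uf; have : (0 <= energy sq setT theta)%E.
  by apply: esum_ge0 => e _; rewrite lee_fin sqr_ge0.
case En : (energy _ _ _) => [E|//|//] E0 _.
have E1 : 0 < E + 1 by rewrite lee_fin in E0; lra.
have key n : (E + 1)^-1 <= degree x * (1 - walk_average F (hit_prob R F x n) x).
  have := @laplacian_hit_prob_ge x n theta E uf.
  by rewrite laplacianE hit_prob_root; apply; rewrite En.
have d0 : 0 < degree x.
  rewrite lt_neqAle degree_ge0 andbT eq_sym; apply/eqP => d0.
  by have := key 0%N; rewrite d0 mul0r leNgt invr_gt0 E1.
apply: (@le_lt_trans _ _ (1 - (E + 1)^-1 / degree x)).
  apply: ge_sup; first by exists (walk_average F (hit_prob R F x 0) x), 0%N.
  move=> _ [n _ <-]; rewrite lerBrDr -lerBrDl ler_pdivrMr// mulrC.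
  exact: key.
by rewrite ltrBlDr ltrDl divr_gt0// invr_gt0.
Qed.

Lemma walk_flow_out (w : seq (dart G)) a : a.1 \notin map fst w -> walk_flow R w a = 0.
Proof.
move=> aw; rewrite /walk_flow.
have cnt (b : dart G) : b.1 \notin map fst w -> count_mem b w = 0%N.
  by move=> bw; apply/count_memPn; apply: contra bw; exact: map_f.
by rewrite !cnt// subrr.
Qed.

(** Prepending a walk from y to x changes the flow on finitely many edges only. *)
Lemma unit_flow_reroot x y theta : unit_flow F x theta -> cluster F y x ->
  (energy sq setT theta < +oo)%E ->
  exists theta', unit_flow F y theta' /\
    (energy sq setT theta' < +oo)%E.
Proof.
move=> uf [w [yx wF]] fin; have div_theta := unit_flow_divergence uf.
have [anti supp _ _] := uf.
exists (fun a => theta a + walk_flow R w a).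
have div' z : divergence (fun a => theta a + walk_flow R w a) z = (z == y)%:R.
  by rewrite divergenceD// div_theta (divergence_walk_flow _ _ lf yx) addrC subrK.
split.
  split.
  - by move=> a; rewrite anti (@walk_flow_antisymmetric R G w a) -opprD.
  - move=> a nFa; rewrite supp// walk_flow_out ?addr0//.
    by apply/mapP => -[b bw ab]; apply: nFa; rewrite ab; exact: wF.
  - by rewrite div' eqxx.
  - by move=> z /eqP zy; rewrite div' (negbTE zy).
have finw : (energy sq setT (walk_flow R w) < +oo)%E.
  rewrite /energy (esumID [set` map fst w]); last first.
    by move=> e _; rewrite lee_fin sqr_ge0.
  rewrite setTI [X in (_ + X)%E]esum1; last first.
    by move=> e [_ /negP ew]; rewrite walk_flow_out// normr0 expr0n.
  rewrite adde0 esum_fset ?fsumEFin ?ltry//.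
apply: (@le_lt_trans _ _ (\esum_(e in setT) ((2 * `|theta (e, true)| ^+ 2)%:E
    + (2 * `|walk_flow R w (e, true)| ^+ 2)%:E))%E).
  apply: le_esum => e _; rewrite -EFinD lee_fin !real_normK ?num_real//.
  by have := sqr_ge0 (theta (e, true) - walk_flow R w (e, true)); nra.
rewrite esumD; try by move=> e _; rewrite lee_fin mulr_ge0// sqr_ge0.
apply: lte_add_pinfty; (apply: le_lt_trans; first apply: esum_mulr_le => //);
  try by move=> e _; exact: sqr_ge0.
  exact: lte_mul_pinfty.
exact: lte_mul_pinfty.
Qed.

Lemma transient_of_flow x theta : unit_flow F x theta ->
  (energy sq setT theta < +oo)%E -> transient_cluster R F x.
Proof.
move=> uf fin y xy; have [theta' [uf' fin']] := unit_flow_reroot uf (cluster_sym xy) fin.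
exact: return_prob_lt1 uf' fin'.
Qed.

End Transience.

(** * Closed events in the space of configurations *)

Section ProductMeasurable.
Implicit Types (E : choiceType).

(** Used both for random fields, with the measurable sets of the probability space,
and for maps between configuration spaces, with the product sigma-algebra. *)
Lemma sigma_algebra_preimage_bits (E : Type) (W : Type) (S : set (set W))
    (X : W -> E -> bool) (U : set (E -> bool)) :
  sigma_algebra setT S -> (forall e, S [set w | X w e]) ->
  product_measurable U -> S (X @^-1` U).
Proof.
move=> sS XS; have [S0 SC SU] := sS.
apply: (@smallest_sub _ _ _ [set V | S (X @^-1` V)]).
  split=> /=; first by rewrite preimage_set0.
    by move=> V /SC.
  by move=> V SV; rewrite preimage_bigcup; exact: SU.
by move=> _ [e _ <-]; exact: XS.
Qed.

Lemma product_measurableC (E : Type) (U : set (E -> bool)) :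
  product_measurable U -> product_measurable (~` U).
Proof. by rewrite -setTD; exact: sigma_algebraCD. Qed.

Lemma product_measurable_bigcup (E : Type) (U : nat -> set (E -> bool)) :
  (forall n, product_measurable (U n)) -> product_measurable (\bigcup_n U n).
Proof. exact: sigma_algebra_bigcup. Qed.

Lemma product_measurable_bigcap (E : Type) (U : nat -> set (E -> bool)) :
  (forall n, product_measurable (U n)) -> product_measurable (\bigcap_n U n).
Proof.
move=> mU; rewrite -[X in product_measurable X]setCK setC_bigcap.
apply: product_measurableC; apply: product_measurable_bigcup => n.
by apply: product_measurableC; exact: mU.
Qed.

Lemma product_measurableU (E : Type) (U V : set (E -> bool)) :
  product_measurable U -> product_measurable V -> product_measurable (U `|` V).
Proof.
move=> mU mV; rewrite -bigcup2E; apply: product_measurable_bigcup => -[|[|n]] //=.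
exact: sigma_algebra0.
Qed.

Lemma product_measurableI (E : Type) (U V : set (E -> bool)) :
  product_measurable U -> product_measurable V -> product_measurable (U `&` V).
Proof.
move=> mU mV; rewrite -[X in product_measurable X]setCK setCI.
by apply: product_measurableC; apply: product_measurableU; exact: product_measurableC.
Qed.

Lemma product_measurable_bit (E : Type) (e : E) :
  product_measurable [set c : E -> bool | c e].
Proof. by apply: sub_sigma_algebra; exists e. Qed.

(** Induction on the list of coordinates: split according to the value of the first
one, which may then be fixed by updating the configuration. *)
Lemma product_measurable_cylinder E (s : seq E) (U : set (E -> bool)) :
  (forall c c', (forall e, e \in s -> c e = c' e) -> U c -> U c') ->
  product_measurable U.
Proof.
elim: s U => [|e s IH] U cylU.
  have [[c Uc]|U0] := pselect (exists c, U c).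
    rewrite (_ : U = ~` set0) ?setC0; last first.
      by apply/seteqP; split=> // c' _; exact: cylU Uc.
    by rewrite -setC0; apply: product_measurableC; exact: sigma_algebra0.
  rewrite (_ : U = set0); first exact: sigma_algebra0.
  by rewrite -subset0 => c Uc; apply: U0; exists c.
pose upd b (c : E -> bool) e' := if e' == e then b else c e'.
have mupd b : product_measurable (upd b @^-1` U).
  apply: IH => c c' cc'; apply: cylU => e'; rewrite inE /upd.
  by case: eqP => //= _ /cc'.
have updE c : upd (c e) c = c.
  by apply/funext => e'; rewrite /upd; case: eqP => [->|].
have -> : U = ([set c : E -> bool | c e] `&` upd true @^-1` U) `|`
    (~` [set c : E -> bool | c e] `&` upd false @^-1` U).
  apply/seteqP; split=> c; rewrite /setU /setI /setC /preimage /=; have := updE c.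
    by case: (c e) => -> Uc; [left|right].
  by case: (c e) => -> [[]|[]].
apply: product_measurableU; apply: product_measurableI => //.
  exact: product_measurable_bit.
by apply: product_measurableC; exact: product_measurable_bit.
Qed.

(** Finite lists rather than single elements, so that an empty E has such a
sequence too. *)
Definition exhausts E (s : nat -> seq E) :=
  forall e, exists n, forall m, (n <= m)%N -> e \in s m.

Lemma exhaustsP E : countable [set: E] -> exists s, @exhausts E s.
Proof.
move=> /countable_injP[f finj].
have fin n : finite_set (f @^-1` `I_n).
  apply: finite_preimage (finite_II n) => e e' _ _.
  by apply: finj; rewrite inE.
exists (fun n => finmap.enum_fset (fset_set (f @^-1` `I_n))) => e.
exists (f e).+1 => m fem.
by rewrite [_ \in _]in_fset_set// inE.
Qed.

Lemma exhausts_seq E (s : nat -> seq E) (t : seq E) : exhausts s ->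
  exists n, forall m, (n <= m)%N -> {subset t <= s m}.
Proof.
move=> es; elim: t => [|e t [n tn]]; first by exists 0%N.
have [k ek] := es e; exists (maxn k n) => m; rewrite geq_max => /andP[km nm] e'.
by rewrite inE => /orP[/eqP ->|/(tn _ nm)//]; exact: ek.
Qed.

(** The hypothesis says that U is closed in the product topology.  Such a U is the
intersection of the cylinder events that some member of U agrees with c on the
n-th list of an exhaustion. *)
Lemma product_measurable_closed E (U : set (E -> bool)) :
  countable [set: E] ->
  (forall c, (forall s : seq E,
     exists c', U c' /\ forall e, e \in s -> c' e = c e) -> U c) ->
  product_measurable U.
Proof.
move=> /exhaustsP[s es] clU.
have -> : U = \bigcap_n [set c | exists c', U c' /\ forall e, e \in s n -> c' e = c e].
  apply/seteqP; split=> c Uc; first by move=> n _; exists c.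
  apply: clU => t; have [n tn] := exhausts_seq t es.
  have [c' [Uc' cc']] := Uc n I; exists c'; split=> // e /(tn _ (leqnn n)).
  exact: cc'.
apply: product_measurable_bigcap => n; apply: (@product_measurable_cylinder _ (s n)).
move=> c c' cc' [c'' [Uc'' c''c]]; exists c''; split=> // e es'.
by rewrite c''c// cc'.
Qed.

End ProductMeasurable.

(** * Events that a flow of bounded energy exists *)

Section FlowEvent.
Variables (R : realType) (B : multigraph) (o : vertex B) (Phi : R -> R).
Hypothesis lf : locally_finite B.
Hypothesis gPhi : gauge Phi.

Definition flow_event (M : R) : set (edge B -> bool) :=
  [set c | exists theta : dart B -> R, unit_flow [set e | c e] o theta /\
     (energy Phi setT theta <= M%:E)%E].

Lemma flow_event_increasing M : increasing_event (flow_event M).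
Proof.
move=> c c' [theta [[anti supp div1 div0] le_en]] cc'.
exists theta; split => //; split => // a nc'; apply: supp => ca; apply: nc'.
exact: cc'.
Qed.

(** A flow on the open edges may be restricted to the cluster of o: no open edge
joins a cluster vertex to the outside, so no divergence is created. *)
Lemma supports_flowP (c : edge B -> bool) :
  supports_finite_energy_flow Phi [set e | c e] o <->
  exists n : nat, flow_event n%:R c.
Proof.
set F := [set e | c e]; split.
  move=> [theta [[anti supp div1 div0]]]; rewrite /energy => fin.
  have en_eq : energy Phi setT theta = energy Phi (cluster_edges F o) theta.
    rewrite /energy (esumID (cluster_edges F o)); last first.
      by move=> e _; rewrite lee_fin gauge_ge0.
    rewrite setTI [X in (_ + X)%E]esum1 ?adde0// => e [_ ne].
    by rewrite (supp (e, true))// normr0 gauge0.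
  have : (0 <= energy Phi (cluster_edges F o) theta)%E.
    by apply: esum_ge0 => e _; rewrite lee_fin gauge_ge0.
  move: fin en_eq; rewrite -/(energy Phi (cluster_edges F o) theta).
  case: (energy Phi (cluster_edges F o) theta) => [M _ en_eq M0|//|//].
  exists (Num.truncn M).+1, theta; split; last first.
    rewrite en_eq lee_fin; apply: ltW; exact: truncnS_gt.
  by split => // a nFa; apply: supp => -[].
move=> [n [theta [uf le_en]]]; have [anti supp _ _] := uf.
pose theta' (a : dart B) := if `[< cluster_edges F o a.1 >] then theta a else 0.
have div' x : divergence theta' x = (x == o)%:R.
  have [ox|nox] := pselect (cluster F o x).
    rewrite -(unit_flow_divergence uf); apply: eq_fsbigr => a /set_mem[ax _].
    rewrite /theta'; case: asboolP => // na; rewrite supp// => Fa.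
    by apply: na; apply/cluster_edges_tail; rewrite ax.
  have -> : (x == o) = false.
    by apply/eqP => xo; apply: nox; rewrite xo; exact: cluster_refl.
  apply: fsbig1 => a [ax _]; rewrite /theta'; case: asboolP => // /cluster_edges_tail[_].
  by rewrite ax.
exists theta'; split.
  split.
  - by move=> a; rewrite /theta' /=; case: ifP; rewrite ?oppr0.
  - by move=> a na; rewrite /theta'; case: asboolP.
  - by rewrite div' eqxx.
  - by move=> x /eqP xo; rewrite div' (negbTE xo).
apply: (@le_lt_trans _ _ n%:R%:E); last exact: ltry.
apply: le_trans le_en.
apply: le_trans (esum_subset_le _ (@subsetT _ (cluster_edges F o))).
by apply: le_esum => e De; rewrite lee_fin /theta'; case: asboolP.
Qed.

(** Antisymmetric flows are determined by their values on reference orientations,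
which places the compactness argument in a product of intervals indexed by edges. *)
Definition dart_extension (u : edge B -> R) (a : dart B) : R :=
  if a.2 then u a.1 else - u a.1.

Local Notation space := (prod_topology (fun _ : edge B => R)).

Lemma continuous_fsum (T : topologicalType) (I : choiceType) (A : set I)
    (f : I -> T -> R) : finite_set A -> (forall i, continuous (f i)) ->
  continuous (fun t => \sum_(i \in A) f i t).
Proof.
move=> finA cf; rewrite (_ : (fun t => _) =
    fun t => \sum_(i <- finmap.enum_fset (fset_set A)) f i t); last first.
  by apply/funext => t; rewrite fsbig_finite.
move=> t; elim: (finmap.enum_fset _) => [|i s IH].
  by under eq_fun do rewrite big_nil; exact: cvg_cst.
by under eq_fun do rewrite big_cons; apply: cvgD => //; exact: cf.
Qed.

Lemma continuous_coord (e : edge B) : continuous (fun u : space => u e).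
Proof. exact: (@proj_continuous (edge B) (fun=> R) e). Qed.

Lemma continuous_dart_extension a :
  continuous (fun u : space => dart_extension u a).
Proof.
move=> u; rewrite /dart_extension; case: a.2; first exact: continuous_coord.
apply: (@continuous_comp _ _ _ (fun w : space => w a.1) -%R).
  exact: continuous_coord.
exact: opp_continuous.
Qed.

(** Configurations of the event that agree with c on larger and larger finite sets
carry flows with values in a fixed compact interval.  A cluster point of these
flows in the product topology satisfies every constraint involving finitely
many edges that holds eventually along the sequence: vanishing on an edge that
c closes, the divergence at a vertex, and the bound on a finite partial sum of the
energy. *)
Lemma flow_event_closed M (c : edge B -> bool) : countable [set: edge B] ->
  (forall s : seq (edge B),
     exists c', flow_event M c' /\ forall e, e \in s -> c' e = c e) ->
  flow_event M c.
Proof.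
move=> /exhaustsP[s es] approx.
have /choice[theta thetaP] : forall n, exists theta : dart B -> R,
    [/\ antisymmetric_flow theta,
      (forall e, e \in s n -> c e = false -> theta (e, true) = 0),
      (forall x, divergence theta x = (x == o)%:R) &
      (energy Phi setT theta <= M%:E)%E].
  move=> n; have [c' [[theta [uf le_en]] cc']] := approx (s n).
  exists theta; have [anti supp _ _] := uf; split => //.
    by move=> e en ce; apply: supp => /=; rewrite cc'// ce.
  exact: unit_flow_divergence uf.
have le_sum n (A : set (edge B)) : finite_set A ->
    \sum_(e \in A) Phi `|theta n (e, true)| <= M.
  move=> finA; have [_ _ _ le_en] := thetaP n.
  rewrite -lee_fin; apply: le_trans le_en; apply: esum_ge.
  by exists A => //; rewrite fsumEFin.
(* The bound of [gauge_bounded] on each edge value. *)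
pose b := 1 + M / Phi 1.
pose u n : space := fun e => theta n (e, true).
have ub n e : `|u n e| <= b.
  apply: gauge_bounded => //.
  by have := @le_sum n [set e] (finite_set1 e); rewrite fsbig_set1.
have cpt : compact [set v : space | forall e, `[- b, b]%classic (v e)].
  apply: (@tychonoff (edge B) (fun=> R) (fun=> `[- b, b]%classic)) => e.
  exact: segment_compact.
have [|v [_ clv]] := cpt (u @ \oo) _.
  exists 0%N => // n _ e /=; rewrite in_itv/= -ler_norml; exact: ub.
(* Closed conditions that hold eventually along the sequence pass to v. *)
have lim_closed (C : set space) : closed C ->
    (exists n, forall m, (n <= m)%N -> C (u m)) -> C v.
  move=> clC [n Cn]; apply: clC => V nV; apply: clv => //.
  by exists n => // m /= nm; exact: Cn.
have uE n a : dart_extension (u n) a = theta n a.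
  have [anti _ _ _] := thetaP n.
  by case: a => e []; rewrite /dart_extension/u //= -(anti (e, true)).
exists (dart_extension v).
have divv x : divergence (dart_extension v) x = (x == o)%:R.
  apply: (lim_closed [set w | divergence (dart_extension w) x = (x == o)%:R]).
    apply: (@preimage_closed _ _ (fun w : space =>
      \sum_(a \in out_darts setT x) dart_extension w a)
      [set t | t = _]); last exact: closed_eq.
    by move=> w _; apply: continuous_fsum => // a; exact: continuous_dart_extension.
  exists 0%N => m _ /=; rewrite (eq_divergence _ (uE m)).
  by case: (thetaP m).
split.
  split.
  - by case=> e []; rewrite /dart_extension //= opprK.
  - move=> a /= nca; suff : v a.1 = 0.
      by rewrite /dart_extension => ->; case: ifP; rewrite ?oppr0.
    apply: (lim_closed [set w | w a.1 = 0]).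
      apply: (@preimage_closed _ _ (fun w : space => w a.1) [set 0]); last exact: closed_eq.
      by move=> w _; exact: continuous_coord.
    have [n an] := es a.1; exists n => m nm /=.
    by have [_ + _ _] := thetaP m; apply; [exact: an|exact/negbTE/negP].
  - by rewrite divv eqxx.
  - by move=> x /eqP xo; rewrite divv (negbTE xo).
apply: ge_ereal_sup => _ [A [finA _] <-]; rewrite fsumEFin// lee_fin.
apply: (lim_closed [set w | \sum_(e \in A) Phi `|w e| <= M]).
  apply: (@preimage_closed _ _ (fun w : space => \sum_(e \in A) Phi `|w e|)
    [set t | t <= M]); last exact: closed_le.
  move=> w _; apply: continuous_fsum => // e {}w.
  apply: (@continuous_comp _ _ _ (fun w : space => w e) (fun t => Phi `|t|)).
    exact: continuous_coord.
  exact: gauge_norm_continuous.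
by exists 0%N => m _; exact: le_sum.
Qed.

Lemma product_measurable_flow_event M : connected_graph B ->
  product_measurable (flow_event M).
Proof.
move=> conn; have ce := countable_edges o lf conn.
by apply: product_measurable_closed => // c; exact: flow_event_closed.
Qed.

End FlowEvent.

(** * Repairability under Bernoulli failures *)

Section Probability.
Variables (R : realType) (d : measure_display) (W : measurableType d).
Variables (P : probability W R).

Lemma measurable_field_event (E : choiceType) (X : W -> E -> bool) U :
  random_field X -> product_measurable U -> measurable (X @^-1` U).
Proof.
move=> rX; apply: sigma_algebra_preimage_bits => //.
exact: sigma_algebra_measurable.
Qed.

(** Countable subadditivity, in the form needed to pass from some flow of finite
energy to a flow with a fixed energy bound. *)
Lemma positive_probability_bigcup (E : choiceType) (X : W -> E -> bool)
    (S : set (E -> bool)) (U : nat -> set (E -> bool)) :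
  random_field X -> (forall n, product_measurable (U n)) ->
  S `<=` \bigcup_n U n -> with_positive_probability P X S ->
  exists n, (0 < P (X @^-1` U n))%E.
Proof.
move=> rX mU SU [V [mV VS]]; apply: contraPP => /forallNP U0.
have mXU n := measurable_field_event rX (mU n).
apply/negP; rewrite -leNgt.
have : P.-negligible (\bigcup_n X @^-1` U n).
  apply: negligible_bigcup => n; exists (X @^-1` U n); split => //.
  by apply/eqP; rewrite eq_le measure_ge0 andbT leNgt; exact/negP/U0.
move=> /negligibleS negl.
rewrite (@measure_negligible _ _ _ P)//; first exact: measurable_field_event.
apply: negl => w /= /VS/SU[n _ Un]; by exists n.
Qed.

End Probability.

Section RepairField.
Variables (B H : multigraph) (M : repair_model B H).
Hypothesis lfH : locally_finite H.

(** The routes of e are walks from a fixed vertex, hence countable in number. *)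
Lemma product_measurable_repairable e :
  product_measurable [set c | repairable M c e].
Proof.
have : countable (routes M e).
  apply: (@sub_countable _ _ _ [set w | exists y, walk (site M (src e)) w y]).
    by apply: subset_card_le => w /routes_path[sw _]; exists (site M (tgt e)).
  exact: countable_walks.
move=> /countable_injP[f finj].
have -> : [set c | repairable M c e] = \bigcup_n
    [set c | exists w, [/\ routes M e w, f w = n & walk_in [set x | c x] w]].
  apply/seteqP; split=> c.
    by move=> /asboolP[w [ew cw]]; exists (f w) => //; exists w.
  by move=> [n _ [w [ew _ cw]]]; apply/asboolP; exists w.
apply: product_measurable_bigcup => n.
have [[w [ew wn]]|no] := pselect (exists w, routes M e w /\ f w = n); last first.
  apply: (@product_measurable_cylinder _ [::]) => c c' _ [w [ew wn _]].
  by case: no; exists w.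
apply: (@product_measurable_cylinder _ (map fst w)) => c c' cc' [w' [ew' w'n cw']].
have ww' : w' = w by apply: finj; rewrite ?inE// w'n.
by exists w; split=> // a aw /=; rewrite -cc' ?map_f// ; apply: cw'; rewrite ww'.
Qed.

Lemma product_measurable_preimage_repairable (U : set (edge B -> bool)) :
  product_measurable U -> product_measurable [set c | U (repairable M c)].
Proof.
apply: (sigma_algebra_preimage_bits (X := repairable M)).
  exact: smallest_sigma_algebra.
exact: product_measurable_repairable.
Qed.

End RepairField.

(** * Lifted flows on the open physical network *)

Section LiftedFlow.
Variables (R : realType) (B H : multigraph) (M : repair_model B H).
Variables (o : vertex B) (Phi : R -> R) (L K : nat).
Hypothesis lfB : locally_finite B.
Hypothesis lfH : locally_finite H.
Hypothesis gPhi : gauge Phi.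
Hypothesis K1 : (1 <= K)%N.
Hypothesis alpha_fin : forall m, (1 <= m <= K)%N -> (gauge_alpha Phi m < +oo)%E.

Lemma lifted_flow (S : set (edge B)) (c : edge H -> bool) g theta :
  let D := cluster_edges S o in
  let openH := [set f | c f] in
  open_selection M c D g -> controlled L K D g ->
  unit_flow D o theta -> (energy Phi D theta < +oo)%E ->
  [/\ unit_flow (cluster_edges openH (site M o)) (site M o) (lift_flow D g theta),
    (energy Phi setT (lift_flow D g theta)
       <= L%:R%:E * gauge_beta Phi K * energy Phi D theta)%E,
    (energy Phi setT (lift_flow D g theta) < +oo)%E &
    ((forall t, 0 <= t -> Phi t = t ^+ 2) ->
       transient_cluster R openH (site M o))].
Proof.
move=> D openH sel ctl uf fin.
have gpath e : D e -> simple_path (site M (src e)) (g e) (site M (tgt e)).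
  by move=> /sel[/routes_path].
have Do : D `<=` cluster_edges D o.
  move=> e De; split => //; have [_ [w [ow wS]]] := De.
  by exists w; split => //; exact: walk_in_cluster_edges ow wS.
have ufl : unit_flow (cluster_edges openH (site M o)) (site M o) (lift_flow D g theta).
  by apply: unit_flow_lift uf _ Do => // [|e /sel[]//]; exact: ctl.
have [b [b0 beta_b bP]] := gauge_betaP gPhi K1 alpha_fin.
have le_en : (energy Phi setT (lift_flow D g theta)
       <= L%:R%:E * b%:E * energy Phi D theta)%E.
  exact: (energy_lift ctl theta gPhi b0 bP).
have lift_fin : (energy Phi setT (lift_flow D g theta) < +oo)%E.
  apply: le_lt_trans le_en _; rewrite -EFinM; apply: lte_mul_pinfty => //.
  by rewrite lee_fin mulr_ge0.
split => //; first by rewrite beta_b.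
move=> sqPhi; apply: (@transient_of_flow _ _ openH lfH (site M o) (lift_flow D g theta)).
  by case: ufl => anti supp div1 div0; split => // a na; apply: supp => -[].
rewrite /energy; apply: le_lt_trans lift_fin; apply: le_esum => e _.
by rewrite sqPhi.
Qed.

(** The deterministic implication behind the event of positive probability. *)
Lemma supports_lifted_flow (S : set (edge B)) (c : edge H -> bool) g :
  open_selection M c (cluster_edges S o) g ->
  controlled L K (cluster_edges S o) g ->
  supports_finite_energy_flow Phi S o ->
  supports_finite_energy_flow Phi [set f | c f] (site M o) /\
  ((forall t, 0 <= t -> Phi t = t ^+ 2) ->
    transient_cluster R [set f | c f] (site M o)).
Proof.
move=> sel ctl [theta [uf fin]].
have [ufl _ lift_fin tr] := lifted_flow sel ctl uf fin.
split => //; exists (lift_flow (cluster_edges S o) g theta); split => //.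
by apply: le_lt_trans lift_fin; exact: esum_subset_le.
Qed.

End LiftedFlow.

Theorem theorem4p3 (R : realType) (r p rho : R) (Phi : R -> R)
    (B : multigraph) (o : vertex B) (H : multigraph) (M : repair_model B H)
    (d : measure_display) (W : measurableType d) (P : probability W R)
    (xi : W -> edge H -> bool) (Rdep L K : nat) :
  0 < r < 1 ->
  0 <= p <= 1 ->
  gauge Phi ->
  connected_graph B -> locally_finite B ->
  infinite_set [set: vertex B] -> bounded_degree B ->
  gauge_energy_stable o Phi r ->
  locally_finite H ->
  bernoulli_field P xi p ->
  (1 <= L)%N -> (1 <= K)%N ->
  (forall m, (1 <= m <= K)%N -> (gauge_alpha Phi m < +oo)%E) ->
  (* (i) *)
  dependent_field Rdep P (fun w => repairable M (xi w)) ->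
  (* (ii) *)
  domination_threshold B Rdep r rho ->
  (rho%:E <= inf_marginal P (fun w => repairable M (xi w)))%E ->
  (* (iii) *)
  (forall (c : edge H -> bool) (S : set (edge B)),
    (forall e, S e -> repairable M c e) ->
    exists g, open_selection M c (cluster_edges S o) g /\
              controlled L K (cluster_edges S o) g) ->
  with_positive_probability P xi
    [set c : edge H -> bool | exists x : vertex H,
      supports_finite_energy_flow Phi [set f | c f] x /\
      ((forall t, 0 <= t -> Phi t = t ^+ 2) ->
       transient_cluster R [set f | c f] x)] /\
  (* any coupling of the physical configuration [xi'] with a dominated
     Bernoulli field [om] *)
  (forall (d' : measure_display) (W' : measurableType d')
      (P' : probability W' R)
      (xi' : W' -> edge H -> bool) (om : W' -> edge B -> bool),
    bernoulli_field P' xi' p ->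
    bernoulli_field P' om r ->
    {ae P', forall w, forall e, om w e -> repairable M (xi' w) e} ->
    {ae P', forall w,
      let D := cluster_edges [set e | om w e] o in
      let openH := [set f | xi' w f] in
      forall theta : dart B -> R,
      unit_flow D o theta -> (energy Phi D theta < +oo)%E ->
      (exists g, open_selection M (xi' w) D g /\ controlled L K D g) /\
      (forall g, open_selection M (xi' w) D g -> controlled L K D g ->
        [/\ unit_flow (cluster_edges openH (site M o)) (site M o)
              (lift_flow D g theta),
            (energy Phi setT (lift_flow D g theta)
               <= L%:R%:E * gauge_beta Phi K * energy Phi D theta)%E &
            ((forall t, 0 <= t -> Phi t = t ^+ 2) ->
             transient_cluster R openH (site M o))])}).
Proof.
move=> _ _ gPhi conn lfB _ _ stable lfH berxi _ K1 alpha_fin dep dom marg repair.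
split.
  have [d0 [W0 [P0 [X [berX posX]]]]] := stable.
  have mU (n : nat) := product_measurable_flow_event o lfB gPhi n%:R conn.
  have [n Un] : exists n : nat, (0 < P0 (X @^-1` flow_event o Phi n%:R))%E.
    have [rX _ _] := berX.
    apply: (positive_probability_bigcup rX mU _ posX) => c.
    by move=> /(supports_flowP o gPhi c)[n Un]; exists n.
  pose V := [set c | flow_event o Phi n%:R (repairable M c)].
  have mV : product_measurable V := product_measurable_preimage_repairable M lfH (mU n).
  have [rxi _ _] := berxi.
  have rY : random_field (fun w => repairable M (xi w)).
    by move=> e; exact: measurable_field_event (product_measurable_repairable M lfH e).
  exists V; split => //.
    move=> c Vc; exists (site M o).
    (* All repaired edges are taken as the demand subgraph. *)
    have [g [sel ctl]] := repair c [set e | repairable M c e] (fun _ => id).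
    apply: (supports_lifted_flow lfB lfH gPhi K1 alpha_fin sel ctl).
    by apply/(supports_flowP o gPhi); exists n.
  apply: lt_le_trans Un _.
  apply: (dom.2 _ _ _ _ rY dep marg _ _ _ _ berX _ (mU n)).
  exact: flow_event_increasing.
move=> d' W' P' xi' om _ _; apply: filterS => w om_le theta uf fin.
split; first exact: repair.
by move=> g sel ctl; have [] := lifted_flow lfB lfH gPhi K1 alpha_fin sel ctl uf fin.
Qed.
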